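(* Let $\mathcal{L}$ be a lattice satisfying conditions (i)–(iii) of the context, and fix a type of walk, either self-avoiding walks (SAWs) or self-avoiding trails (SATs). Let $0\le m<n$ be integers, let $\mathcal{P}$ be a partition of the set of all $m$-step walks of the chosen type starting from any of the representatives $v_1,\dots,v_K$, and let $Z^{\mathcal{P}}(m,n)$ be the set of those $\mathbf{z}\in\mathbb{R}_{>0}^d$ for which $\mathcal{P}$ is admissible with respect to $\mathbf{z}$ and the matrix $\mathbf{G}^{\mathcal{P}}(m,n)=\mathbf{G}^{\mathcal{P}}_{\mathbf{z}}(m,n)$ is primitive, in the sense of the context. Define $$\mathcal{D}^{\mathcal{P}}(m,n)=\bigcup_{\substack{\mathbf{z}\in Z^{\mathcal{P}}(m,n)\\ \lambda_1(\mathbf{G}^{\mathcal{P}}_{\mathbf{z}}(m,n))<1}}[-\mathbf{z},\mathbf{z}],\qquad [-\mathbf{z},\mathbf{z}]=\prod_{i=1}^d[-\mathbf{z}_i,\mathbf{z}_i]\subset\mathbb{R}^d.$$ Then $\mathcal{D}^{\mathcal{P}}(m,n)$ is open, and for all $1\le k\le K$ the anisotropic generating function $$g_k(\mathbf{x})=\sum_{\mathbf{n}\in\mathbb{Z}_{\ge 0}^d} c_{\mathbf{n},k}\,\mathbf{x}^{\mathbf{n}}$$ converges absolutely on $\mathcal{D}^{\mathcal{P}}(m,n)$. In particular, $g_k(\mathbf{x})$ is analytic on $\mathcal{D}^{\mathcal{P}}(m,n)$.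
   Context: A lattice is a (possibly directed) infinite graph, embedded in a finite-dimensional Euclidean space, whose drawing forms a regular tiling. A translation of the lattice is a translation of the ambient Euclidean space mapping the lattice to itself. The lattice $\mathcal{L}$ is assumed to satisfy: (i) there is a finite number $K$ of equivalence classes of vertices, denoted $\mathcal{V}_1,\dots,\mathcal{V}_K$, under the translations of the lattice; (ii) the (out-)degree of any vertex is finite; (iii) the lattice is strongly connected, i.e., any vertex can be joined to any other vertex by a walk. Denote by $\mathcal{E}_1,\dots,\mathcal{E}_d$ the equivalence classes of edges of $\mathcal{L}$ under its translations. Fix representatives $v_k\in\mathcal{V}_k$, $1\le k\le K$. For $n\ge 1$, an $n$-step walk on $\mathcal{L}$ is a sequence $(v_0,e_1,v_1,\dots,e_n,v_n)$ of $n$ edges and $n+1$ vertices such that $e_i$ connects $v_{i-1}$ to $v_i$ for all $1\le i\le n$; $v_0$ is its starting point. It is a self-avoiding walk (SAW) if the vertices $v_0,\dots,v_n$ are distinct, and a self-avoiding trail (SAT) if the edges $e_1,\dots,e_n$ are distinct. A single vertex is regarded as a $0$-step SAW (and SAT) of weight $1$. Below, ''SAW'' is to be read as ''SAT'' throughout if the chosen type is SATs. For $\mathbf{n}\in\mathbb{Z}_{\ge0}^d$ and $1\le k\le K$, $c_{\mathbf{n},k}$ is the number of SAWs starting from a fixed vertex in $\mathcal{V}_k$ that contain exactly $\mathbf{n}_i$ edges of $\mathcal{E}_i$ for each $1\le i\le d$ (independent of the vertex), and $\mathbf{x}^{\mathbf{n}}=\prod_{i=1}^d\mathbf{x}_i^{\mathbf{n}_i}$.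 Given $\mathbf{z}\in\mathbb{R}_{>0}^d$, the weight of a SAW $\gamma$ is $\mathbf{w}(\gamma)=\prod_{i=1}^d \mathbf{z}_i^{N_i(\gamma)}$, where $N_i(\gamma)$ is the number of edges of $\gamma$ belonging to $\mathcal{E}_i$; the weight $\mathbf{w}(e)$ of a single edge $e\in\mathcal{E}_i$ is $\mathbf{z}_i$. A symmetry $\tau$ of $\mathcal{L}$ is weight-preserving (with respect to $\mathbf{z}$) if $\mathbf{w}(e)=\mathbf{w}(\tau(e))$ for all edges $e$ of $\mathcal{L}$. Let $\mathcal{P}=\{\mathcal{P}_1(m),\dots,\mathcal{P}_t(m)\}$ be a partition of the set of all $m$-step SAWs starting from any of $v_1,\dots,v_K$. For $n>m$ and $1\le r,s\le t$, let $\mathbf{F}^{\mathcal{P}}_{rs}(m,n)$ be the sum of the weights of all $n$-step SAWs that start with (i.e., whose first $m$ steps form) a fixed $m$-step SAW in $\mathcal{P}_r(m)$ and end with (i.e., whose last $m$ steps form) a translation of any $m$-step SAW in $\mathcal{P}_s(m)$. The partition $\mathcal{P}$ is called admissible with respect to $\mathbf{z}$ (for the given $m,n$) if, for each $1\le s\le t$, any two walks in $\mathcal{P}_s(m)$ are related by a weight-preserving symmetry of the lattice, and each $\mathbf{F}^{\mathcal{P}}_{rs}(m,n)$ is well-defined, i.e., does not depend on the choice of the fixed SAW in $\mathcal{P}_r(m)$. In that case define the $t\times t$ matrix $$\mathbf{G}^{\mathcal{P}}_{\mathbf{z}}(m,n)=\left[\frac{\mathbf{F}^{\mathcal{P}}_{rs}(m,n)}{\mathbf{w}(\gamma_r(m))}\right]_{1\le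 r,s\le t},$$ where $\gamma_r(m)\in\mathcal{P}_r(m)$ is arbitrary (all walks in $\mathcal{P}_r(m)$ have the same weight). A square matrix is primitive if it is nonnegative and some positive-integer power of it has all entries positive; for a primitive matrix $A$, $\lambda_1(A)>0$ denotes its dominant (Perron–Frobenius) eigenvalue. *)

(* Defs.v *)
From HB Require Import structures.
From mathcomp Require Import all_boot all_order all_algebra.
From mathcomp Require Import complex finmap.
From mathcomp Require Import all_classical all_reals all_analysis.

Set Implicit Arguments.
Unset Strict Implicit.
Unset Printing Implicit Defensive.

Import Order.TTheory GRing.Theory Num.Theory.
Import numFieldNormedType.Exports.

Local Open Scope classical_set_scope.
Local Open Scope ring_scope.

(* Multigraph. When [directed] is false, an edge may be traversed both ways
   (the order of [src] and [tgt] is then immaterial), but it remains a single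
   edge, which matters for trails. *)
Record graph := Graph {
  vertex : choiceType;
  edge : choiceType;
  src : edge -> vertex;
  tgt : edge -> vertex;
  directed : bool }.

Definition connects (G : graph) (e : edge G) (u v : vertex G) : Prop :=
  (src e = u /\ tgt e = v) \/
  (~~ directed G /\ src e = v /\ tgt e = u).

(* An infinite graph drawn in Euclidean space: distinct vertices are distinct
   points, an edge is drawn as a curve joining its ends, and an edge is
   determined by its ends and its drawing. Periodicity ("regular tiling") is
   expressed by [representatives] below. *)
Record lattice (R : realType) := Lattice {
  gr :> graph;
  dim : nat;
  pos : vertex gr -> 'rV[R]_dim;
  drawing : edge gr -> set 'rV[R]_dim;
  vertex_infinite : infinite_set [set: vertex gr];
  pos_inj : injective pos;
  drawing_curve : forall e : edge gr,
    exists2 c : R -> 'rV[R]_dim, {within `[0, 1], continuous c} &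
      [/\ c 0 = pos (src e), c 1 = pos (tgt e) & c @` `[0, 1] = drawing e];
  drawing_inj : forall e e' : edge gr, drawing e = drawing e' ->
    (forall u v, connects e u v <-> connects e' u v) -> e = e' }.

Section Lattice.
Context {R : realType} (L : lattice R).

Let V := vertex L.
Let E := edge L.
Let space := 'rV[R]_(dim L).

(* The map [phi] of the ambient space maps the lattice to itself, acting on
   vertices by [fV] and on edges by [fE]. *)
Definition lattice_map (phi : space -> space) (fV : V -> V) (fE : E -> E) :=
  [/\ bijective fV, bijective fE,
      forall v, pos (fV v) = phi (pos v),
      forall e, drawing (fE e) = phi @` drawing e &
      forall e u v, connects (fE e) (fV u) (fV v) <-> connects e u v].

Definition translation (fV : V -> V) (fE : E -> E) : Prop :=
  exists a : space, lattice_map (fun x => x + a) fV fE.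

(* The norm of 'rV[R]_n in the library is the sup norm, hence this. *)
Definition sqdist (x y : space) : R := \sum_i (x 0 i - y 0 i) ^+ 2.

Definition symmetry (fV : V -> V) (fE : E -> E) : Prop :=
  exists2 phi : space -> space,
    forall x y, sqdist (phi x) (phi y) = sqdist x y & lattice_map phi fV fE.

Definition vertex_equiv (u v : V) : Prop :=
  exists fV fE, translation fV fE /\ fV u = v.

Definition edge_equiv (e e' : E) : Prop :=
  exists fV fE, translation fV fE /\ fE e = e'.

(* There are exactly K classes of vertices, with representatives [rep k]. *)
Definition representatives (K : nat) (rep : 'I_K -> V) : Prop :=
  forall v, exists! k, vertex_equiv (rep k) v.

(* There are exactly d classes of edges, the fibres of [cls]. *)
Definition edge_classes (d : nat) (cls : E -> 'I_d) : Prop :=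
  (forall i, exists e, cls e = i) /\
  (forall e e', cls e = cls e' <-> edge_equiv e e').

Definition finite_outdegree : Prop :=
  forall u, finite_set [set e : E | exists v, connects e u v].

(* (v0, [:: (e1, v1); ...; (en, vn)]) stands for (v0, e1, v1, ..., en, vn). *)
Definition steps := (V * seq (E * V))%type.

Fixpoint walk_from (u : V) (s : seq (E * V)) : Prop :=
  if s is (e, v) :: s' then connects e u v /\ walk_from v s' else True.

Definition is_walk (w : steps) : Prop := walk_from w.1 w.2.

Definition start (w : steps) : V := w.1.
Definition wlength (w : steps) : nat := size w.2.
Definition walk_vertices (w : steps) : seq V := w.1 :: [seq p.2 | p <- w.2].
Definition walk_edges (w : steps) : seq E := [seq p.1 | p <- w.2].
Definition terminus (w : steps) : V := last w.1 [seq p.2 | p <- w.2].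

Definition strongly_connected : Prop :=
  forall u v, exists w, [/\ is_walk w, start w = u & terminus w = v].

Inductive walk_type := SAW | SAT.

Definition avoiding (ty : walk_type) (w : steps) : Prop :=
  is_walk w /\
  match ty with
  | SAW => uniq (walk_vertices w)
  | SAT => uniq (walk_edges w)
  end.

Definition first_steps (m : nat) (w : steps) : steps := (w.1, take m w.2).

Definition last_steps (m : nat) (w : steps) : steps :=
  let j := (size w.2 - m)%N in
  (last w.1 [seq p.2 | p <- take j w.2], drop j w.2).

Definition map_walk (fV : V -> V) (fE : E -> E) (w : steps) : steps :=
  (fV w.1, [seq (fE p.1, fV p.2) | p <- w.2]).

Definition walk_translate (w w' : steps) : Prop :=
  exists fV fE, translation fV fE /\ map_walk fV fE w = w'.

Section Weights.
Context (d : nat) (cls : E -> 'I_d).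

Definition edge_count (w : steps) (i : 'I_d) : nat :=
  count (fun e => cls e == i) (walk_edges w).

Definition monomial (x : 'rV[R]_d) (n : {ffun 'I_d -> nat}) : R :=
  \prod_i x 0 i ^+ n i.

Definition weight (z : 'rV[R]_d) (w : steps) : R :=
  \prod_i z 0 i ^+ edge_count w i.

Definition edge_weight (z : 'rV[R]_d) (e : E) : R := z 0 (cls e).

Definition weight_preserving (z : 'rV[R]_d) (fE : E -> E) : Prop :=
  forall e, edge_weight z e = edge_weight z (fE e).

Context (ty : walk_type).

(* The set counted is finite when out-degrees are. *)
Definition walk_count (v : V) (n : {ffun 'I_d -> nat}) : nat :=
  #|` fset_set [set w | [/\ avoiding ty w, start w = v &
                            forall i, edge_count w i = n i]] |%fset.

Definition gterm (v : V) (x : 'rV[R]_d) (n : {ffun 'I_d -> nat}) : R :=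
  (walk_count v n)%:R * monomial x n.

Context (K : nat) (rep : 'I_K -> V) (m n : nat).

Definition initial_walks : set steps :=
  [set w | [/\ avoiding ty w, wlength w = m & exists k, start w = rep k]].

Context (t : nat) (P : 'I_t -> set steps).

Definition Fsum (z : 'rV[R]_d) (w0 : steps) (s : 'I_t) : R :=
  \sum_(w \in [set w | [/\ avoiding ty w, wlength w = n,
                           first_steps m w = w0 &
                           exists2 w1, P s w1 &
                             walk_translate w1 (last_steps m w)]]) weight z w.

Definition admissible (z : 'rV[R]_d) : Prop :=
  (forall s w w', P s w -> P s w' ->
     exists fV fE, [/\ symmetry fV fE, weight_preserving z fE &
                       map_walk fV fE w = w']) /\
  (forall r s w w', P r w -> P r w' -> Fsum z w s = Fsum z w' s).

(* [gam r] is a chosen walk of P_r. *)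
Definition Gmx (gam : 'I_t -> steps) (z : 'rV[R]_d) : 'M[R]_t :=
  \matrix_(r, s) (Fsum z (gam r) s / weight z (gam r)).

End Weights.
End Lattice.

Section Matrices.
Context {R : realType} (t : nat).

Definition primitive (A : 'M[R]_t) : Prop :=
  (forall i j, 0 <= A i j) /\
  exists2 p : nat, (0 < p)%N & forall i j, 0 < (A ^+ p) i j.

(* l is an eigenvalue of A of largest modulus among all complex eigenvalues.
   Being real and nonnegative it is unique; for primitive A it exists and is
   the Perron-Frobenius eigenvalue. *)
Definition dominant_eigenvalue (A : 'M[R]_t) (l : R) : Prop :=
  eigenvalue A l /\
  forall mu : R[i], eigenvalue (map_mx (real_complex R) A) mu ->
    `|mu| <= real_complex R l.

End Matrices.

Section PowerSeries.
Context {R : realType}.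

Definition abs_summable (I : choiceType) (f : I -> R) : Prop :=
  summable [set: I] (EFin \o f).

(* Sum of an absolutely summable family. *)
Definition unordered_sum (I : choiceType) (f : I -> R) : R :=
  fine (\esum_(i in [set: I]) ((EFin \o f)^\+)%E i -
        \esum_(i in [set: I]) ((EFin \o f)^\-)%E i)%E.

Definition analytic_at (d : nat) (f : 'rV[R]_d -> R) (a : 'rV[R]_d) : Prop :=
  exists (c : {ffun 'I_d -> nat} -> R) (r : R), 0 < r /\
    forall x : 'rV[R]_d, (forall i, `|x 0 i - a 0 i| < r) ->
      abs_summable (fun n => c n * monomial (x - a) n) /\
      f x = unordered_sum (fun n => c n * monomial (x - a) n).

Definition box (d : nat) (z : 'rV[R]_d) : set 'rV[R]_d :=
  [set x | forall i, - z 0 i <= x 0 i <= z 0 i].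

End PowerSeries.

Section Domain.
Context {R : realType} (L : lattice R) (d : nat) (cls : edge L -> 'I_d).
Context (ty : walk_type) (m n t : nat) (P : 'I_t -> set (steps L)).
Context (gam : 'I_t -> steps L).

Definition Zset : set 'rV[R]_d :=
  [set z : 'rV[R]_d | [/\ forall i, 0 < z 0 i, admissible cls ty m n P z &
               primitive (Gmx cls ty m n P gam z)]].

Definition Dset : set 'rV[R]_d :=
  \bigcup_(z in [set z | Zset z /\
      exists2 l, dominant_eigenvalue (Gmx cls ty m n P gam z) l & l < 1])
    box z.

Definition gen_fun (v : vertex L) (x : 'rV[R]_d) : R :=
  unordered_sum (gterm cls ty v x).

End Domain.

(* Main.v *)
Require Import Defs.
From mathcomp Require Import all_boot all_order all_algebra.
From mathcomp Require Import complex finmap.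
From mathcomp Require Import all_classical all_reals all_analysis.
From mathcomp Require Import ring lra.
Import Order.TTheory GRing.Theory Num.Theory.
Import numFieldNormedType.Exports.

Set Implicit Arguments.
Unset Strict Implicit.
Unset Printing Implicit Defensive.

Local Open Scope classical_set_scope.
Local Open Scope ring_scope.

(** Let z be admissible with G = G_z nonnegative and lambda_1(G) < 1.

    Convergence at z.  An avoiding walk of length at least n whose first m
    steps form w0 consists of its first n steps y, which are counted by an
    entry of G, followed by a walk that starts with the last m steps of y;
    the two pieces overlap in those m steps and every piece of an avoiding
    walk is avoiding.  If U_r denotes the total weight of the walks of length
    at most N that start with a given walk of class r, divided by the weight
    of that walk, this overlap decomposition gives U(N + 1) <= C + G U(N),
    entry by entry, where C accounts for the finitely many walks shorter than
    n.  Hence any nonnegative vector with C + G B <= B bounds U uniformly in N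
    ([sum_extensions], [walk_sums_bounded]).  Such a vector is a multiple of
    (1 - G)^-1 1, which is nonnegative because G is nonnegative and has no
    real eigenvalue in [1, oo) ([nonneg_resolvent]).  All walks are compared
    with those starting at the finitely many representatives by translating
    them, which preserves weights and takes avoiding walks to avoiding walks.

    Openness.  The set of such z is stable under z |-> c z for c > 1 close
    to 1: all walks counted by an entry of G gain n - m steps over the walk
    they start with, so G_(c z) = c^(n-m) G_z.  As the box of c z contains a
    neighbourhood of the box of z, the union is open ([subcritical_enlarge]).

    Analyticity.  The same enlargement leaves room r around a point a of the
    box: |a_i| + r is at most c z_i.  Expanding x^n = (a + (x - a))^n with the
    binomial theorem in each variable gives an absolutely summable double
    family, dominated by the series at c z, and exchanging the two summations
    is the Taylor expansion at a ([power_series_analytic]). *)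

(** * Nonnegative matrices without eigenvalues beyond one *)

Lemma dominant_eigenvalue_bound (R : realType) (t : nat) (A : 'M[R]_t) (l a : R) :
  dominant_eigenvalue A l -> eigenvalue A a -> `|a| <= l.
Proof.
case=> _ dom; rewrite -(eigenvalue_map (real_complex R)) => /dom.
by rewrite normc_def /= expr0n /= addr0 sqrtr_sqr lecR.
Qed.

Lemma continuous_bigmin (R : realType) (I : Type) (r : seq I) (f : I -> R -> R)
    (y x : R) :
  (forall i, {for x, continuous (f i)}) ->
  {for x, continuous (fun s => \big[Order.min/y]_(i <- r) f i s)}.
Proof.
move=> fc; elim: r => [|i r IH].
  rewrite (_ : (fun _ => _) = fun=> y); first exact: cst_continuous.
  by apply/funext => s; rewrite big_nil.
rewrite (_ : (fun _ => _) =
  (f i) \min (fun s => \big[Order.min/y]_(i <- r) f i s)).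
  exact: continuous_min.
by apply/funext => s; rewrite big_cons.
Qed.

Section Resolvent.
Variables (R : realType) (t : nat) (A : 'M[R]_t).
Hypothesis A_ge0 : forall i j, 0 <= A i j.
Hypothesis eigen_lt1 : forall a, eigenvalue A a -> a < 1.

(** A kernel vector of 1 - s A is an eigenvector of A for 1 / s >= 1. *)
Lemma det_resolvent_neq0 (s : R) : 0 <= s <= 1 -> \det (1%:M - s *: A) != 0.
Proof.
case/andP=> s0 s1; apply/negP => /det0P [v v0 /eqP].
rewrite mulmxBr mulmx1 subr_eq0 -scalemxAr => /eqP vE.
have sn0 : s != 0.
  by apply: contra_neq v0 => s00; rewrite vE s00 scale0r.
have : eigenvalue A s^-1.
  apply/eigenvalueP; exists v => //.
  by rewrite [in RHS]vE scalerA mulVf // scale1r.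
move/eigen_lt1; apply/negP; rewrite -leNgt invf_ge1 //.
by rewrite lt_def sn0.
Qed.

(* Cramer's rule over polynomials in s gives the continuity of the entries
   of the inverse. *)
Let resolvent_mx : 'M[{poly R}]_t := 1%:M - 'X *: map_mx (@polyC R) A.
Let num : 'cV[{poly R}]_t := \adj resolvent_mx *m const_mx 1.
Let sol (i : 'I_t) (s : R) : R := (num i 0).[s] / (\det resolvent_mx).[s].

Let eval_resolvent s : map_mx (horner_eval s) resolvent_mx = 1%:M - s *: A.
Proof.
apply/matrixP => i j; rewrite !mxE /horner_eval !hornerE.
by rewrite hornerMn hornerC.
Qed.

Let eval_det s : (\det resolvent_mx).[s] = \det (1%:M - s *: A).
Proof. by rewrite -eval_resolvent det_map_mx. Qed.

Let sol_eq (s : R) : 0 <= s <= 1 ->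
  forall i, sol i s = 1 + s * \sum_j A i j * sol j s.
Proof.
move=> s01 i; have Dn0 := det_resolvent_neq0 s01.
have numE : \col_j (num j 0).[s] = \adj (1%:M - s *: A) *m const_mx 1.
  apply/matrixP => j k; rewrite ord1 {k} [LHS]mxE [in LHS]mxE [RHS]mxE horner_sum.
  apply: eq_bigr => k _; rewrite -eval_resolvent -map_mx_adj hornerM.
  by rewrite [in RHS]mxE ![const_mx _ _ _]mxE hornerE.
have : (1%:M - s *: A) *m \col_j sol j s = const_mx 1.
  have -> : \col_j sol j s = (\det (1%:M - s *: A))^-1 *: \col_j (num j 0).[s].
    apply/matrixP => j k; rewrite [LHS]mxE [RHS]mxE [in RHS]mxE.
    by rewrite /sol eval_det mulrC.
  rewrite numE -scalemxAr mulmxA mul_mx_adj mul_scalar_mx scalerA.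
  by rewrite mulVf // scale1r.
rewrite mulmxBl mul1mx => /matrixP /(_ i 0); rewrite !mxE => /eqP.
rewrite subr_eq => /eqP ->; congr (_ + _).
rewrite mulr_sumr; apply: eq_bigr => j _; by rewrite !mxE -mulrA.
Qed.

Let sol_continuous i (s : R) : 0 <= s <= 1 -> {for s, continuous (sol i)}.
Proof.
move=> s01; apply: cvgM; first exact: continuous_horner.
apply: cvgV; last exact: continuous_horner.
by rewrite eval_det det_resolvent_neq0.
Qed.

(** Follow h(s) = (1 - s A)^-1 1 as s runs from 0 to 1; it is continuous
    because 1 - s A stays invertible.  As h(s) = 1 + s A h(s), entries that are
    all nonnegative are all at least 1, so the least entry of h(s) can never
    cross the gap between 0 and 1 and stays nonnegative from h(0) = 1 on. *)
Lemma nonneg_resolvent :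
  exists h : 'I_t -> R, (forall i, 0 <= h i) /\
    forall i, h i = 1 + \sum_j A i j * h j.
Proof.
(* Capping the minimum at 1 makes g locally constant where it is nonnegative. *)
pose g s := \big[Order.min/(1:R)]_i sol i s.
have g_le1 s : g s <= 1 by rewrite /g; apply: bigmin_le_id.
have g_ge1 (s : R) : 0 <= s <= 1 -> 0 <= g s -> g s = 1.
  move=> s01 gs; have sol_ge0 i : 0 <= sol i s.
    exact: le_trans gs (bigmin_le _ _ _).
  apply/le_anti; rewrite g_le1 /=; apply/bigmin_geP; split => // i _.
  rewrite sol_eq // lerDl mulr_ge0 //; first by case/andP: s01.
  by apply: sumr_ge0 => j _; rewrite mulr_ge0.
have g0 : g 0 = 1.
  apply: g_ge1; rewrite ?lexx ?ler01 //; apply/bigmin_geP; split=> // i _.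
  by rewrite sol_eq ?lexx ?ler01 // mul0r addr0.
have g1 : 0 <= g 1.
  rewrite leNgt; apply/negP => g1.
  have gc : {within `[(0:R), 1], continuous g}.
    apply: continuous_in_subspaceT => s; rewrite inE /= in_itv /= => s01.
    by apply: continuous_bigmin => i; exact: sol_continuous.
  have [||c] := @IVT R g 0 1 (2^-1) _ gc; first exact: ler01.
    by rewrite g0 ge_min le_max; lra.
  rewrite in_itv /= => c01 gE.
  have := g_ge1 c c01; rewrite gE; lra.
exists (sol^~ 1); split => [i|i].
  exact: le_trans g1 (bigmin_le _ _ _).
by rewrite /= [LHS]sol_eq ?lexx ?ler01 // mul1r.
Qed.

End Resolvent.

Section ScaleMatrix.
Variables (R : realType) (t : nat).
Implicit Types A : 'M[R]_t.

Lemma expr_scalemx A (c : R) p : (c *: A) ^+ p = c ^+ p *: A ^+ p.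
Proof.
elim: p => [|p IH]; first by rewrite !expr0 scale1r.
by rewrite !exprS IH -[LHS]/(_ *m _) -scalemxAl -scalemxAr scalerA.
Qed.

Lemma primitive_scale A (c : R) : 0 < c -> primitive A -> primitive (c *: A).
Proof.
move=> c0 [A0 [p p0 Ap]]; split=> [i j|]; first by rewrite mxE mulr_ge0 // ltW.
by exists p => // i j; rewrite expr_scalemx mxE mulr_gt0 // exprn_gt0.
Qed.

Lemma eigenvalue_scale (F : fieldType) (A : 'M[F]_t) (c a : F) : c != 0 ->
  eigenvalue (c *: A) (c * a) = eigenvalue A a.
Proof.
move=> c0; apply/eigenvalueP/eigenvalueP => -[v vA v0]; exists v => //.
  apply: (scalerI c0); by rewrite scalerA scalemxAr.
by rewrite -scalemxAr vA scalerA.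
Qed.

Lemma dominant_eigenvalue_scale A (c l : R) : 0 < c ->
  dominant_eigenvalue A l -> dominant_eigenvalue (c *: A) (c * l).
Proof.
move=> c0 [Al dom]; split=> [|mu]; first by rewrite eigenvalue_scale // gt_eqF.
have cc0 : real_complex R c != 0 by rewrite fmorph_eq0 gt_eqF.
rewrite map_mxZ -[mu](mulVKf cc0) eigenvalue_scale // => /dom mule.
rewrite normrM rmorphM /= ger0_norm; last by rewrite ler0c ltW.
by apply: ler_wpM2l => //; rewrite ler0c ltW.
Qed.

End ScaleMatrix.

(** * Absolutely summable families *)

Section UnorderedSum.
Variable R : realType.

Lemma le_abs_summable (I : choiceType) (f g : I -> R) :
  (forall i, `|f i| <= `|g i|) -> abs_summable g -> abs_summable f.
Proof.
move=> fg; apply: le_lt_trans; apply: le_esum => i _ /=.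
by rewrite lee_fin.
Qed.

Lemma abs_summableP (I : choiceType) (f : I -> R) :
  abs_summable f <-> (\esum_(i in [set: I]) `|f i|%:E < +oo)%E.
Proof. by []. Qed.

Lemma abs_summable_ge0 (I : choiceType) (f : I -> R) : (forall i, 0 <= f i) ->
  abs_summable f <-> (\esum_(i in [set: I]) (f i)%:E < +oo)%E.
Proof.
move=> f0; rewrite /abs_summable /summable.
by under eq_esum do rewrite /= ger0_norm //.
Qed.

Lemma esum_fineK (I : choiceType) (f : I -> R) : (forall i, 0 <= f i) ->
  abs_summable f ->
  (fine (\esum_(i in [set: I]) (f i)%:E))%:E = \esum_(i in [set: I]) (f i)%:E.
Proof.
move=> f0 /(abs_summable_ge0 f0) sf; rewrite fineK // ge0_fin_numE //.
by apply: esum_ge0 => i _; rewrite lee_fin.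
Qed.

(** Any decomposition into nonnegative summable families computes the sum,
    not only the positive and negative parts that define it.  This reduces the
    rules for signed sums to those for sums of nonnegative families. *)
Lemma unordered_sumB (I : choiceType) (f g : I -> R) :
  (forall i, 0 <= f i) -> (forall i, 0 <= g i) ->
  abs_summable f -> abs_summable g ->
  unordered_sum (fun i => f i - g i) =
  fine (\esum_(i in [set: I]) (f i)%:E) - fine (\esum_(i in [set: I]) (g i)%:E).
Proof.
move=> f0 g0 sf sg; rewrite /unordered_sum.
have -> : EFin \o (fun i => f i - g i) = ((EFin \o f) \- (EFin \o g))%E by [].
rewrite esumB //; last 2 first.
- by move=> i _ /=; rewrite lee_fin.
- by move=> i _ /=; rewrite lee_fin.
by rewrite -(esum_fineK f0 sf) -(esum_fineK g0 sg).
Qed.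

Definition pos_part (I : Type) (f : I -> R) (i : I) : R := Num.max (f i) 0.
Definition neg_part (I : Type) (f : I -> R) (i : I) : R := Num.max (- f i) 0.

Lemma pos_part_ge0 (I : Type) (f : I -> R) i : 0 <= pos_part f i.
Proof. by rewrite le_max lexx orbT. Qed.

Lemma neg_part_ge0 (I : Type) (f : I -> R) i : 0 <= neg_part f i.
Proof. by rewrite le_max lexx orbT. Qed.

Lemma pos_neg_part (I : Type) (f : I -> R) i : f i = pos_part f i - neg_part f i.
Proof.
rewrite /pos_part /neg_part; case/orP: (le_total 0 (f i)) => fi.
  by rewrite max_l // max_r ?oppr_le0 // subr0.
by rewrite max_r // max_l ?oppr_ge0 // sub0r opprK.
Qed.

Lemma summable_pos_part (I : choiceType) (f : I -> R) :
  abs_summable f -> abs_summable (pos_part f).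
Proof.
apply: le_abs_summable => i; rewrite ger0_norm ?pos_part_ge0 //.
by rewrite ge_max ler_norm normr_ge0.
Qed.

Lemma summable_neg_part (I : choiceType) (f : I -> R) :
  abs_summable f -> abs_summable (neg_part f).
Proof.
apply: le_abs_summable => i; rewrite ger0_norm ?neg_part_ge0 //.
by rewrite ge_max -normrN ler_norm normr_ge0.
Qed.

Lemma unordered_sumE (I : choiceType) (f : I -> R) : abs_summable f ->
  unordered_sum f = fine (\esum_(i in [set: I]) (pos_part f i)%:E) -
                    fine (\esum_(i in [set: I]) (neg_part f i)%:E).
Proof.
move=> sf; rewrite -unordered_sumB.
- by congr unordered_sum; apply/funext => i; exact: pos_neg_part.
- exact: pos_part_ge0.
- exact: neg_part_ge0.
- exact: summable_pos_part.
- exact: summable_neg_part.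
Qed.

Lemma unordered_sumN (I : choiceType) (f : I -> R) : abs_summable f ->
  unordered_sum (fun i => - f i) = - unordered_sum f.
Proof.
move=> sf; rewrite unordered_sumE.
  rewrite [in RHS]unordered_sumE // opprB; congr (fine _ - fine _).
  by apply: eq_esum => i _; rewrite /neg_part opprK.
by apply: le_abs_summable sf => i; rewrite normrN.
Qed.

Lemma esum_scale (I : choiceType) (f : I -> R) (b : R) : 0 < b ->
  (\esum_(i in [set: I]) (b * f i)%:E = b%:E * \esum_(i in [set: I]) (f i)%:E)%E.
Proof.
move=> b0; rewrite /esum -ereal_sup_pZl //; congr ereal_sup.
rewrite image_comp; apply: eq_imagel => /= X [finX _].
by rewrite (fsumEFin _ finX) (fsumEFin _ finX) -EFinM mulr_fsumr.
Qed.

(** For b = 0 both sides vanish whether or not f is summable; so it is the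
    family multiplied by b that has to be summable. *)
Lemma unordered_sumM (I : choiceType) (f : I -> R) (b : R) :
  abs_summable (fun i => f i * b) ->
  unordered_sum (fun i => f i * b) = unordered_sum f * b.
Proof.
have pos (g : I -> R) (c : R) : 0 < c -> abs_summable g ->
    unordered_sum (fun i => c * g i) = c * unordered_sum g.
  move=> c0 sg; have sM (p : I -> R) : (forall i, 0 <= p i) -> abs_summable p ->
      abs_summable (fun i => c * p i).
    move=> p0 sp; apply/abs_summable_ge0; first by move=> i; rewrite mulr_ge0 // ltW.
    by rewrite esum_scale // -esum_fineK // -EFinM ltry.
  have sp := summable_pos_part sg; have sn := summable_neg_part sg.
  have := @unordered_sumB I (fun i => c * pos_part g i) (fun i => c * neg_part g i).
  rewrite !esum_scale // -(esum_fineK (pos_part_ge0 g) sp).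
  rewrite -(esum_fineK (neg_part_ge0 g) sn) -!EFinM /= -mulrBr.
  rewrite -unordered_sumE // => <- //; last first.
  - exact/sM/sn/neg_part_ge0.
  - exact/sM/sp/pos_part_ge0.
  - by move=> i; rewrite mulr_ge0 ?neg_part_ge0 // ltW.
  - by move=> i; rewrite mulr_ge0 ?pos_part_ge0 // ltW.
  by congr unordered_sum; apply/funext => i; rewrite -mulrBr -pos_neg_part.
have [-> _|b0 sfb] := eqVneq b 0.
  rewrite mulr0 (_ : (fun _ => _) = fun=> 0 - 0); last first.
    by apply/funext => i; rewrite mulr0 subr0.
  have s0 : abs_summable (fun _ : I => 0 : R).
    by rewrite /abs_summable /summable esum1 ?ltry // => i _ /=; rewrite normr0.
  by rewrite unordered_sumB ?subrr.
have sf : abs_summable f.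
  apply/abs_summableP; move/abs_summableP: sfb => sN.
  have fE i : `|f i| = `|b^-1| * `|f i * b| by rewrite -normrM mulrC mulfK.
  under eq_esum do rewrite fE.
  rewrite esum_scale ?normr_gt0 ?invr_eq0 //.
  apply: lte_mul_pinfty => //; by rewrite ?lee_fin ?normr_ge0.
have fbE : (fun i => f i * b) = (fun i => b * f i).
  by apply/funext => i; rewrite mulrC.
have [bp|bn] := ltP 0 b; first by rewrite fbE (mulrC (unordered_sum f)) pos.
have bN : 0 < - b by rewrite oppr_gt0 lt_neqAle b0.
rewrite (_ : unordered_sum f * b = - (- b * unordered_sum f)); last first.
  by rewrite mulNr opprK mulrC.
rewrite -pos // -unordered_sumN; last first.
  by apply: le_abs_summable sfb => i; rewrite mulNr normrN mulrC.
by congr unordered_sum; apply/funext=> i; rewrite mulNr opprK mulrC.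
Qed.

Lemma unordered_sum_reindex (I J : choiceType) (e : I -> J) (f : J -> R) :
  set_bij [set: I] [set: J] e ->
  unordered_sum (fun i => f (e i)) = unordered_sum f.
Proof.
move=> be; rewrite /unordered_sum.
rewrite !(reindex_esum _ _ _ _ be).
by congr (fine (_ - _)); apply: eq_esum => i _; rewrite ?funeposE ?funenegE.
Qed.

Lemma abs_summable_reindex (I J : choiceType) (e : I -> J) (f : J -> R) :
  set_bij [set: I] [set: J] e -> abs_summable f ->
  abs_summable (fun i => f (e i)).
Proof.
by move=> be; rewrite /abs_summable /summable (reindex_esum _ _ _ _ be).
Qed.

(** By Tonelli, the iterated sum of the absolute values is the sum over pairs. *)
Lemma abs_summable_pairE (I J : choiceType) (f : I * J -> R) :
  (\esum_(i in [set: I]) \esum_(j in [set: J]) `|f (i, j)|%:E < +oo)%E ->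
  abs_summable f.
Proof.
move=> sf; apply/abs_summableP; move: sf; rewrite esum_esum; last by move=> *; rewrite lee_fin.
rewrite (_ : _ `*`` _ = setT); last by apply/seteqP; split.
by under eq_esum do rewrite -surjective_pairing.
Qed.

(** Fubini: apply Tonelli to the positive and to the negative part; the inner
    sums of these parts are finite and form a decomposition of the inner sums of
    f to which [unordered_sumB] applies. *)
Lemma unordered_sum_pair (I J : choiceType) (f : I * J -> R) : abs_summable f ->
  [/\ forall i, abs_summable (fun j => f (i, j)),
      abs_summable (fun i => unordered_sum (fun j => f (i, j))) &
      unordered_sum (fun i => unordered_sum (fun j => f (i, j))) =
      unordered_sum f].
Proof.
move=> sf.
have pairE (g : I * J -> R) : (forall p, 0 <= g p) ->
    \esum_(i in [set: I]) \esum_(j in [set: J]) (g (i, j))%:E =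
    \esum_(p in [set: I * J]) (g p)%:E.
  move=> g0; rewrite esum_esum; last by move=> *; rewrite lee_fin.
  rewrite (_ : _ `*`` _ = setT); last by apply/seteqP; split.
  by under eq_esum do rewrite -surjective_pairing.
have fst (g : I * J -> R) : (forall p, 0 <= g p) -> abs_summable g ->
    forall i, abs_summable (fun j => g (i, j)).
  move=> g0 /(abs_summable_ge0 g0); rewrite -pairE // => sg i.
  apply/abs_summable_ge0 => //; apply: le_lt_trans sg.
  apply: esum_ge; exists [set i]; first by split.
  by rewrite fsbig_set1.
have snd (g : I * J -> R) : (forall p, 0 <= g p) -> abs_summable g ->
    \esum_(i in [set: I]) (fine (\esum_(j in [set: J]) (g (i, j))%:E))%:E =
    \esum_(p in [set: I * J]) (g p)%:E.
  move=> g0 sg; rewrite -pairE //; apply: eq_esum => i _.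
  by rewrite esum_fineK //; exact: fst.
have fine0 (g : I * J -> R) : (forall p, 0 <= g p) ->
    forall i, 0 <= fine (\esum_(j in [set: J]) (g (i, j))%:E).
  by move=> g0 i; apply: fine_ge0; apply: esum_ge0 => j _; rewrite lee_fin.
have sp := summable_pos_part sf; have sn := summable_neg_part sf.
have p0 := pos_part_ge0 f; have n0 := neg_part_ge0 f.
have ssnd (g : I * J -> R) : (forall p, 0 <= g p) -> abs_summable g ->
    abs_summable (fun i => fine (\esum_(j in [set: J]) (g (i, j))%:E)).
  move=> g0 sg; apply/abs_summable_ge0; first exact: fine0.
  by rewrite snd //; exact: (proj1 (abs_summable_ge0 g0) sg).
have f1 i : abs_summable (fun j => f (i, j)).
  have sN : abs_summable (fun p => `|f p|).
    by apply: le_abs_summable sf => p; rewrite normr_id.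
  have := fst (fun p => `|f p|) (fun=> normr_ge0 _) sN i.
  by apply: le_abs_summable => j; rewrite normr_id.
have innerE : (fun i => unordered_sum (fun j => f (i, j))) =
    (fun i => fine (\esum_(j in [set: J]) (pos_part f (i, j))%:E) -
              fine (\esum_(j in [set: J]) (neg_part f (i, j))%:E)).
  by apply/funext => i; rewrite unordered_sumE.
split=> //; last first.
  rewrite innerE unordered_sumB; [|exact: fine0|exact: fine0|exact: ssnd..].
  by rewrite !snd // -unordered_sumE.
rewrite innerE; apply: le_lt_trans (lte_add_pinfty (ssnd _ p0 sp) (ssnd _ n0 sn)).
rewrite -esumD //; apply: le_esum => i _ /=.
by rewrite -EFinD lee_fin ler_normB.
Qed.

Lemma unordered_sum_exchange (I J : choiceType) (f : I -> J -> R) :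
  abs_summable (fun p : I * J => f p.1 p.2) ->
  [/\ abs_summable (fun j => unordered_sum (fun i => f i j)),
      forall j, abs_summable (fun i => f i j) &
      unordered_sum (fun i => unordered_sum (fun j => f i j)) =
      unordered_sum (fun j => unordered_sum (fun i => f i j))].
Proof.
move=> sf; have [_ _ ->] := unordered_sum_pair sf.
have be : set_bij [set: J * I] [set: I * J] (fun p => (p.2, p.1)).
  split=> // [[i j] [i' j'] _ _ /= [-> ->] //|[i j] _]; by exists (j, i).
have := unordered_sum_pair (abs_summable_reindex be sf).
case=> /= s1 s2 ->; split => //.
exact/esym/(unordered_sum_reindex (fun p : I * J => f p.1 p.2) be).
Qed.

Lemma esum_finite_support (I : choiceType) (r : seq I) (f : I -> R) : uniq r ->
  (forall i, 0 <= f i) -> (forall i, i \notin r -> f i = 0) ->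
  \esum_(i in [set: I]) (f i)%:E = (\sum_(i <- r) f i)%:E.
Proof.
move=> ur f0 fr; rewrite -sumEFin fsbig_seq // -esum_fset //; last first.
  by move=> i _; rewrite lee_fin.
rewrite [RHS]esum_mkcond; apply: eq_esum => i _.
by case: ifPn => //; rewrite notin_setE /= => /negP /fr ->.
Qed.

Lemma unordered_sum_finite_support (I : choiceType) (r : seq I) (f : I -> R) :
  uniq r -> (forall i, i \notin r -> f i = 0) ->
  unordered_sum f = \sum_(i <- r) f i.
Proof.
move=> ur fr.
have sf : abs_summable f.
  apply/abs_summableP.
  by rewrite (esum_finite_support ur) ?ltry // => i /fr ->; rewrite normr0.
rewrite unordered_sumE // !(esum_finite_support ur) /=.
- by rewrite -sumrB; apply: eq_bigr => i _; rewrite -pos_neg_part.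
- exact: neg_part_ge0.
- by move=> i /fr fi; rewrite /neg_part fi oppr0 maxxx.
- exact: pos_part_ge0.
- by move=> i /fr fi; rewrite /pos_part fi maxxx.
Qed.

End UnorderedSum.

(** * Power series in several variables *)

Section PowerSeries.
Variables (R : realType) (d : nat).
Implicit Types (F : 'I_d -> nat -> R) (k : {ffun 'I_d -> nat}).

(** The multi-indices below (N, ..., N), listed so that a finite sum over them
    is a product of sums over each coordinate. *)
Definition ord_ffuns (N : nat) : seq {ffun 'I_d -> nat} :=
  [seq [ffun i => val (f i)] | f : {ffun 'I_d -> 'I_N}].

Lemma ord_ffuns_uniq N : uniq (ord_ffuns N).
Proof.
rewrite map_inj_uniq ?enum_uniq // => f g /ffunP fg; apply/ffunP => i.
by apply: val_inj; have := fg i; rewrite !ffunE.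
Qed.

Lemma notin_ord_ffuns N k : k \notin ord_ffuns N -> exists i, (N <= k i)%N.
Proof.
move=> kN; apply/existsP; apply: contraNT kN; rewrite negb_exists => /forallP lt.
have lt' i : (k i < N)%N by have := lt i; rewrite -ltnNge.
apply/mapP; exists [ffun i => Ordinal (lt' i)]; first by rewrite mem_enum.
by apply/ffunP => i; rewrite !ffunE.
Qed.

Lemma sum_ord_ffuns F N :
  \sum_(k <- ord_ffuns N) \prod_i F i (k i) = \prod_i \sum_(j < N) F i j.
Proof.
rewrite big_map big_enum /= [RHS]bigA_distr_bigA /=.
by apply: eq_bigr => f _; apply: eq_bigr => i _; rewrite ffunE.
Qed.

Lemma prod_support F N : (forall i j, (N <= j)%N -> F i j = 0) ->
  forall k, k \notin ord_ffuns N -> \prod_i F i (k i) = 0.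
Proof.
by move=> FN k /notin_ord_ffuns [i Ni]; rewrite (bigD1 i) //= FN // mul0r.
Qed.

Definition binomial_term (x y : R) (n j : nat) : R :=
  x ^+ (n - j) * y ^+ j *+ 'C(n, j).

Lemma sum_binomial_term x y n N : (n < N)%N ->
  \sum_(j < N) binomial_term x y n j = (x + y) ^+ n.
Proof.
move=> nN; rewrite exprDn (big_ord_widen _ (binomial_term x y n) nN).
rewrite [RHS]big_mkcond; apply: eq_bigr => j _; case: ifP => // /negbT.
by rewrite -leqNgt => /bin_small jn; rewrite /binomial_term jn mulr0n.
Qed.

(** The term of degree k in y in the expansion of the monomial (x + y)^n; it
    vanishes unless k <= n because of the binomial coefficients. *)
Definition multinomial_term (x y : 'rV[R]_d) (n k : {ffun 'I_d -> nat}) : R :=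
  \prod_i binomial_term (x 0 i) (y 0 i) (n i) (k i).

Lemma multinomial_support x y (n : {ffun 'I_d -> nat}) : exists N,
  (forall k, k \notin ord_ffuns N -> multinomial_term x y n k = 0) /\
  forall x' y', \sum_(k <- ord_ffuns N) multinomial_term x' y' n k =
    monomial (x' + y') n.
Proof.
exists (\max_i n i).+1; have lt i : (n i < (\max_i n i).+1)%N.
  by rewrite ltnS leq_bigmax.
split=> [|x' y'].
  apply: (prod_support (F := fun i => binomial_term (x 0 i) (y 0 i) (n i))).
  by move=> i j /(leq_trans (lt i)) /bin_small nj; rewrite /binomial_term nj mulr0n.
rewrite (sum_ord_ffuns (fun i => binomial_term (x' 0 i) (y' 0 i) (n i))).
by apply: eq_bigr => i _; rewrite sum_binomial_term // mxE.
Qed.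

Lemma multinomial_expansion x y (n : {ffun 'I_d -> nat}) :
  unordered_sum (multinomial_term x y n) = monomial (x + y) n.
Proof.
have [N [supp sumE]] := multinomial_support x y n.
by rewrite (unordered_sum_finite_support (ord_ffuns_uniq N)).
Qed.

Lemma multinomial_term_norm x y (n : {ffun 'I_d -> nat}) k :
  `|multinomial_term x y n k| =
  multinomial_term (map_mx Num.norm x) (map_mx Num.norm y) n k.
Proof.
rewrite normr_prod; apply: eq_bigr => i _.
by rewrite /binomial_term !mxE normrMn normrM !normrX.
Qed.

Lemma esum_multinomial_term x y (n : {ffun 'I_d -> nat}) :
  \esum_(k in [set: {ffun 'I_d -> nat}]) `|multinomial_term x y n k|%:E =
  (monomial (map_mx Num.norm x + map_mx Num.norm y) n)%:E.
Proof.
have [N [supp sumE]] := multinomial_support x y n.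
rewrite (esum_finite_support (ord_ffuns_uniq N)) // => [|k /supp ->].
  by under eq_bigr do rewrite multinomial_term_norm; rewrite sumE.
by rewrite normr0.
Qed.

(** Evaluating at y = 1 isolates the coefficient of y^k, a polynomial in x. *)
Lemma multinomial_term_split (x y : 'rV[R]_d) (n : {ffun 'I_d -> nat}) k :
  multinomial_term x y n k = multinomial_term x (const_mx 1) n k * monomial y k.
Proof.
rewrite /monomial -big_split; apply: eq_bigr => i _ /=.
by rewrite /binomial_term !mxE expr1n mulr1 mulrnAl.
Qed.

Lemma ler_monomial (x y : 'rV[R]_d) n :
  (forall i, 0 <= x 0 i <= y 0 i) -> monomial x n <= monomial y n.
Proof.
move=> xy; apply: ler_prod => i _; have /andP[x0 xyi] := xy i.
by rewrite exprn_ge0 //= lerXn2r // nnegrE (le_trans x0).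
Qed.

(** The absolute values of the terms of the expansion of (x + y)^n add up to
    (|x| + |y|)^n, which z^n dominates. *)
Lemma summable_expansion (c : {ffun 'I_d -> nat} -> R) (x y z : 'rV[R]_d) :
  abs_summable (fun n => c n * monomial z n) ->
  (forall i, `|x 0 i| + `|y 0 i| <= z 0 i) ->
  abs_summable (fun p : _ * _ => c p.1 * multinomial_term x y p.1 p.2).
Proof.
move=> sz xyz; apply: abs_summable_pairE; apply: le_lt_trans sz.
apply: le_esum => n _ /=; have [->|cn0] := eqVneq (c n) 0.
  by rewrite esum1 // => k _; rewrite mul0r normr0.
under eq_esum do rewrite normrM.
rewrite esum_scale ?normr_gt0 // esum_multinomial_term -EFinM lee_fin normrM.
apply: ler_wpM2l => //; apply: le_trans (ler_norm _).
by apply: ler_monomial => i; rewrite !mxE xyz andbT addr_ge0.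
Qed.

(** The k-th Taylor coefficient at a is the sum over n of the coefficients of
    (x - a)^k in c_n (a + (x - a))^n. *)
Lemma power_series_analytic (c : {ffun 'I_d -> nat} -> R) (a z : 'rV[R]_d) (r : R) :
  abs_summable (fun n => c n * monomial z n) ->
  0 < r -> (forall i, `|a 0 i| + r <= z 0 i) ->
  analytic_at (fun x => unordered_sum (fun n => c n * monomial x n)) a.
Proof.
move=> sz r0 az; pose T n k := c n * multinomial_term a (const_mx 1) n k.
exists (fun k => unordered_sum (T^~ k)), r; split=> // x xr.
have sT : abs_summable (fun p : _ * _ => c p.1 * multinomial_term a (x - a) p.1 p.2).
  apply: summable_expansion sz _ => i; apply: le_trans (az i).
  by rewrite lerD2l !mxE ltW.
have [/= srow _ _] := unordered_sum_pair sT.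
have [sk sn sumE] := unordered_sum_exchange
  (f := fun n k => c n * multinomial_term a (x - a) n k) sT.
have TE k : unordered_sum (fun n => c n * multinomial_term a (x - a) n k) =
    unordered_sum (T^~ k) * monomial (x - a) k.
  rewrite -unordered_sumM.
    by congr unordered_sum; apply/funext => n; rewrite multinomial_term_split mulrA.
  rewrite (_ : (fun n => _) = fun n => c n * multinomial_term a (x - a) n k).
    exact: sn.
  by apply/funext => n; rewrite multinomial_term_split mulrA.
have TEf := funext TE; rewrite -TEf; split => //.
rewrite -sumE; congr unordered_sum; apply/funext => n.
have cE k : c n * multinomial_term a (x - a) n k =
  multinomial_term a (x - a) n k * c n by rewrite mulrC.
have := srow n; rewrite (funext cE) => srow'.
by rewrite unordered_sumM // multinomial_expansion (addrC a) subrK mulrC.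
Qed.

End PowerSeries.

(** * Finite sums *)

Section FiniteSums.
Variable R : numDomainType.

Lemma sum_fibres (T T' : eqType) (f : T -> R) (g : T -> T') (l : seq T) :
  \sum_(w <- l) f w = \sum_(y <- undup (map g l)) \sum_(w <- l | g w == y) f w.
Proof.
rewrite (exchange_big_dep xpredT) //= big_seq [RHS]big_seq.
apply: eq_bigr => w wl; rewrite -big_filter.
rewrite (eq_filter (a2 := pred1 (g w))); last by move=> y; rewrite /= eq_sym.
by rewrite filter_pred1_uniq ?undup_uniq ?mem_undup ?map_f // big_seq1.
Qed.

Lemma ler_sum_subset (T : eqType) (f : T -> R) (l l' : seq T) :
  (forall w, 0 <= f w) -> uniq l -> uniq l' -> {subset l <= l'} ->
  \sum_(w <- l) f w <= \sum_(w <- l') f w.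
Proof.
move=> f0 ul ul' ll'; rewrite (perm_big [seq w <- l' | w \in l]); last first.
  apply: uniq_perm => //; first by rewrite filter_uniq.
  by move=> w; rewrite mem_filter andb_idr // => /ll'.
by rewrite big_filter big_mkcond; apply: ler_sum => w _; case: ifP.
Qed.

Lemma ler_sum_fsum (T : choiceType) (f : T -> R) (l : seq T) (A : set T) :
  (forall w, 0 <= f w) -> uniq l -> finite_set A -> (forall w, w \in l -> A w) ->
  \sum_(w <- l) f w <= \sum_(w \in A) f w.
Proof.
move=> f0 ul finA lA; rewrite fsbig_finite //; apply: ler_sum_subset => //.
by move=> w /lA Aw; rewrite in_fset_set // mem_set.
Qed.

End FiniteSums.

(** * Walks and translations *)

Local Notation wlength := Defs.wlength.

Section Walks.
Variables (R : realType) (L : lattice R).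
Implicit Types (u v : vertex L) (s : seq (edge L * vertex L)) (w : steps L).

(** [last_steps] with the number of removed steps as parameter: the tails of
    walks of different lengths that share their first n steps all begin after
    the same number of steps. *)
Definition drop_steps (j : nat) w : steps L :=
  (last w.1 [seq p.2 | p <- take j w.2], drop j w.2).

Lemma walk_from_cat u s1 s2 : walk_from u (s1 ++ s2) <->
  walk_from u s1 /\ walk_from (last u [seq p.2 | p <- s1]) s2.
Proof.
elim: s1 u => [|[e v] s1 IH] u /=; first by split=> // -[].
by rewrite IH; tauto.
Qed.

Lemma avoiding_first_steps ty j w : avoiding ty w -> avoiding ty (first_steps j w).
Proof.
case: w => u s [ws us]; split.
  by move: ws; rewrite /is_walk /= -{1}(cat_take_drop j s) walk_from_cat => -[].
case: ty us => us.
  change (is_true (uniq (u :: [seq p.2 | p <- take j s]))).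
  have : uniq (u :: [seq p.2 | p <- s]) by [].
  by rewrite -{1}(cat_take_drop j s) map_cat -cat_cons cat_uniq => /and3P[].
change (is_true (uniq [seq p.1 | p <- take j s])).
have : uniq [seq p.1 | p <- s] by [].
by rewrite -{1}(cat_take_drop j s) map_cat cat_uniq => /and3P[].
Qed.

Lemma avoiding_drop_steps ty j w : avoiding ty w -> avoiding ty (drop_steps j w).
Proof.
case: w => u s [ws us]; split.
  by move: ws; rewrite /is_walk /= -{1}(cat_take_drop j s) walk_from_cat => -[].
case: ty us => us.
  have : uniq (u :: [seq p.2 | p <- s]) by [].
  rewrite -{1}(cat_take_drop j s) map_cat -cat_cons lastI cat_rcons cat_uniq.
  by case/and3P.
have : uniq [seq p.1 | p <- s] by [].
by rewrite -{1}(cat_take_drop j s) map_cat cat_uniq => /and3P[].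
Qed.

Lemma finite_walks (hdeg : finite_outdegree L) u N :
  finite_set [set w | [/\ is_walk w, start w = u & wlength w = N]].
Proof.
elim: N u => [|N IH] u.
  apply: sub_finite_set (finite_set1 (u, [::])) => -[v s] /= [_ + /eqP].
  by rewrite /start /wlength size_eq0 /= => -> /eqP ->.
pose ends := [set e : edge L | exists v, connects e u v].
pose nbr := [set (e, src e) | e in ends] `|` [set (e, tgt e) | e in ends].
have fin_nbr : finite_set nbr.
  by rewrite finite_setU; split; apply: finite_image; exact: hdeg.
apply: (@sub_finite_set _ _ (\bigcup_(p in nbr)
    ((fun w => (u, (p.1, p.2) :: w.2)) @`
      [set w | [/\ is_walk w, start w = p.2 & wlength w = N]]))); last first.
  by apply: bigcup_finite => // p _; apply: finite_image; exact: IH.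
move=> [v [|[e v'] s]] [] //= [cuv ws] + [sN]; rewrite /start /= => sv.
rewrite {}sv /= in cuv *; exists (e, v'); last by exists (v', s).
have ee : ends e by exists v'.
by case: cuv => [[_ tv]|[_ [sv _]]]; [right|left]; exists e => //; congr (_, _).
Qed.

Lemma finite_short_walks (hdeg : finite_outdegree L) u N :
  finite_set [set w | [/\ is_walk w, start w = u & (wlength w < N)%N]].
Proof.
apply: sub_finite_set (bigcup_finite (finite_II N)
  (fun j _ => finite_walks hdeg u j)).
by move=> w [ww su sN]; exists (wlength w).
Qed.

Lemma last_stepsE m w : last_steps m w = drop_steps (wlength w - m) w.
Proof. by []. Qed.

(** The overlap: the tail that starts after j steps begins with the last m of
    the first m + j steps. *)
Lemma first_drop_steps m j w : (m + j <= wlength w)%N ->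
  first_steps m (drop_steps j w) = last_steps m (first_steps (m + j) w).
Proof.
move=> mj; rewrite last_stepsE /wlength /= size_takel // addKn.
by rewrite /first_steps /drop_steps /= take_drop take_takel // leq_addl.
Qed.

(** Two pieces that leave no gap determine the walk. *)
Lemma drop_steps_inj j k w w' : (j <= k)%N -> first_steps k w = first_steps k w' ->
  drop_steps j w = drop_steps j w' -> w = w'.
Proof.
case: w w' => [u s] [u' s'] jk [-> tk] [_ dj]; congr (_, _).
by rewrite -(cat_take_drop j s) -(take_takel s jk) tk dj (take_takel _ jk) cat_take_drop.
Qed.

Lemma translation_inv fV fE : @translation R L fV fE ->
  exists gV gE, [/\ translation gV gE, cancel fV gV, cancel gV fV &
                    cancel fE gE /\ cancel gE fE].
Proof.
case=> a [[gV fgV gfV] [gE fgE gfE] fpos fdraw fcon].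
exists gV, gE; split => //; exists (- a); split.
- by exists fV.
- by exists fE.
- by move=> v; rewrite -[in RHS](gfV v) fpos /= addrK.
- move=> e; rewrite -[in RHS](gfE e) fdraw image_comp -[LHS]image_id.
  by congr (_ @` _); apply/funext => x; rewrite /comp addrK.
- by move=> e u v; rewrite -fcon gfE !gfV.
Qed.

Lemma translation_comp fV fE gV gE : @translation R L fV fE ->
  translation gV gE -> translation (gV \o fV) (gE \o fE).
Proof.
move=> [a [bfV bfE fpos fdraw fcon]] [b [bgV bgE gpos gdraw gcon]].
exists (a + b); split.
- exact: bij_comp.
- exact: bij_comp.
- by move=> v /=; rewrite gpos fpos /= addrA.
- move=> e /=; rewrite gdraw fdraw image_comp; congr (_ @` _).
  by apply/funext => x /=; rewrite addrA.
- by move=> e u v /=; rewrite gcon fcon.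
Qed.

Lemma map_walk_comp fV fE gV gE w :
  @map_walk R L gV gE (map_walk fV fE w) = map_walk (gV \o fV) (gE \o fE) w.
Proof. by rewrite /map_walk /= -map_comp. Qed.

Lemma map_walkK fV fE gV gE : cancel fV gV -> cancel fE gE ->
  cancel (@map_walk R L fV fE) (map_walk gV gE).
Proof.
move=> fgV fgE [u s]; rewrite map_walk_comp /map_walk /= fgV; congr (_, _).
by rewrite -[RHS]map_id; apply: eq_map => -[e v] /=; rewrite fgV fgE.
Qed.

Lemma map_first_steps fV fE m w :
  @map_walk R L fV fE (first_steps m w) = first_steps m (map_walk fV fE w).
Proof. by rewrite /map_walk /first_steps /= map_take. Qed.

Lemma map_last_steps fV fE m w :
  @map_walk R L fV fE (last_steps m w) = last_steps m (map_walk fV fE w).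
Proof.
rewrite /map_walk /last_steps /= map_drop size_map -map_take; congr (_, _).
by rewrite -(last_map fV) -!map_comp.
Qed.

Lemma wlength_map fV fE w : wlength (@map_walk R L fV fE w) = wlength w.
Proof. by rewrite /wlength size_map. Qed.

Lemma avoiding_map ty fV fE w : @translation R L fV fE -> avoiding ty w ->
  avoiding ty (map_walk fV fE w).
Proof.
case=> a [/bij_inj iV /bij_inj iE _ _ fcon]; case: w => u s [ws us]; split.
  rewrite /is_walk /= in ws *.
  elim: s u ws {us} => //= -[e v] s IH u /= [c ws].
  by split; [apply/fcon|exact: IH].
case: ty us => us.
  have -> : walk_vertices (map_walk fV fE (u, s)) = map fV (walk_vertices (u, s)).
    by rewrite /walk_vertices /= -!map_comp.
  by rewrite map_inj_uniq.
have -> : walk_edges (map_walk fV fE (u, s)) = map fE (walk_edges (u, s)).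
  by rewrite /walk_edges /= -!map_comp.
by rewrite map_inj_uniq.
Qed.

Section Weight.
Variables (d : nat) (cls : edge L -> 'I_d).
Implicit Types z : 'rV[R]_d.

(** The weight does not involve the vertices, and is multiplicative under
    concatenation. *)
Lemma weightE z w : weight cls z w = \prod_(p <- w.2) z 0 (cls p.1).
Proof.
case: w => u s; rewrite /weight /edge_count /walk_edges /=.
elim: s => [|[e v] s IH] /=; first by rewrite big_nil big1.
rewrite big_cons -IH -[z 0 (cls e)]mulr1 /=.
under eq_bigr do rewrite exprD; rewrite big_split /= mulr1; congr (_ * _).
rewrite (bigD1 (cls e)) //= eqxx big1 ?mulr1 // => i.
by rewrite eq_sym => /negPf ->.
Qed.

Lemma weight_gt0 z (z_gt0 : forall i, 0 < z 0 i) w : 0 < weight cls z w.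
Proof. by apply: prodr_gt0 => i _; rewrite exprn_gt0. Qed.

Lemma weight_split z j w :
  weight cls z w = weight cls z (first_steps j w) * weight cls z (drop_steps j w).
Proof. by rewrite !weightE -big_cat cat_take_drop. Qed.

Lemma weight_map_translation z (hcls : edge_classes cls) fV fE w :
  translation fV fE -> weight cls z (map_walk fV fE w) = weight cls z w.
Proof.
move=> tf; rewrite !weightE big_map; apply: eq_bigr => p _ /=; congr (z _ _).
by have [_ classesE] := hcls; apply/esym/classesE; exists fV, fE.
Qed.

Lemma weight_map_preserving z fV fE w :
  weight_preserving cls z fE -> weight cls z (map_walk fV fE w) = weight cls z w.
Proof.
by move=> tf; rewrite !weightE big_map; apply: eq_bigr => p _; rewrite -[LHS]tf.
Qed.

Lemma weight_scale z (c : R) w :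
  weight cls (c *: z) w = c ^+ wlength w * weight cls z w.
Proof.
rewrite !weightE /Defs.wlength; elim: w.2 => [|p s IH].
  by rewrite !big_nil expr0 mulr1.
by rewrite !big_cons IH mxE /= exprS; ring.
Qed.

End Weight.
End Walks.

(** * The overlap decomposition *)

Section WalkBound.
Variables (R : realType) (L : lattice R).
Variables (K : nat) (rep : 'I_K -> vertex L) (hrep : representatives rep).
Hypothesis hdeg : finite_outdegree L.
Variables (d : nat) (cls : edge L -> 'I_d) (hcls : edge_classes cls).
Variables (ty : walk_type) (m n : nat) (hmn : (m < n)%N).
Variables (t : nat) (P : 'I_t -> set (steps L)).
Hypothesis hP : classical_sets.partition [set: 'I_t] P (initial_walks ty rep m).
Variables (gam : 'I_t -> steps L) (hgam : forall r, P r (gam r)).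
Variable z : 'rV[R]_d.
Hypothesis z_gt0 : forall i, 0 < z 0 i.
Hypothesis z_adm : admissible cls ty m n P z.

Let wt := weight cls z.
Let G := Gmx cls ty m n P gam z.

Let wt_ge0 w : 0 <= wt w.
Proof. by apply/ltW/weight_gt0. Qed.

Definition has_type (r : 'I_t) (w : steps L) : Prop :=
  exists2 w1, P r w1 & walk_translate w1 w.

Lemma to_representative u : exists k fV fE gV gE,
  [/\ translation fV fE, translation gV gE, fV (rep k) = u /\ gV u = rep k,
      cancel (@map_walk R L fV fE) (map_walk gV gE) &
      cancel (@map_walk R L gV gE) (map_walk fV fE)].
Proof.
have [k [[fV [fE [tf fu]]] _]] := hrep u.
have [gV [gE [tg fgV gfV [fgE gfE]]]] := translation_inv tf.
exists k, fV, fE, gV, gE; split => //; [|exact: map_walkK..].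
by split=> //; rewrite -fu fgV.
Qed.

Lemma class_avoiding r w : P r w -> avoiding ty w /\ wlength w = m.
Proof.
case: hP => coverP _ _ Prw.
have : initial_walks ty rep m w by rewrite -coverP; exists r.
by case.
Qed.

(** The start of w can be translated to a representative, and there P covers
    all walks. *)
Lemma exists_type w : avoiding ty w -> wlength w = m -> exists r, has_type r w.
Proof.
move=> aw lw; have [k [fV [fE [gV [gE [tf tg [_ gu] _ gf]]]]]] := to_representative (start w).
have : initial_walks ty rep m (map_walk gV gE w).
  split; [exact: avoiding_map|by rewrite wlength_map|by exists k].
case: hP => <- _ _ [r _ Pr]; exists r, (map_walk gV gE w) => //.
by exists fV, fE; split => //; rewrite gf.
Qed.

(** Weight-preserving symmetries link the walks of a class. *)
Lemma wt_type r w : has_type r w -> wt w = wt (gam r).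
Proof.
case=> w1 Pw1 [fV [fE [tf <-]]]; rewrite /wt weight_map_translation //.
case: z_adm => sym _; have [gV [gE [_ pg <-]]] := sym _ _ _ (hgam r) Pw1.
exact: weight_map_preserving.
Qed.

(** A bound, common to all starting points, for the walks to which the
    decomposition does not apply. *)
Definition short_sum : R :=
  \sum_k \sum_(w \in [set w | [/\ is_walk w, start w = rep k & (wlength w < n)%N]]) wt w.

Lemma short_walks_bound u (l : seq (steps L)) : uniq l ->
  (forall w, w \in l -> [/\ avoiding ty w, start w = u & (wlength w < n)%N]) ->
  \sum_(w <- l) wt w <= short_sum.
Proof.
move=> ul lP; have [k [fV [fE [gV [gE [_ tg [_ gu] _ gf]]]]]] := to_representative u.
have -> : \sum_(w <- l) wt w = \sum_(w <- map (map_walk gV gE) l) wt w.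
  by rewrite big_map; apply: eq_bigr => w _; rewrite /wt weight_map_translation.
rewrite /short_sum (bigD1 k) //= -[leLHS]addr0; apply: lerD; last first.
  by apply: sumr_ge0 => j _; apply: fsumr_ge0 => w _.
apply: ler_sum_fsum => //.
- by rewrite map_inj_uniq //; exact: can_inj gf.
- exact: finite_short_walks.
- move=> _ /mapP[w /lP[aw su lw] ->]; split; last by rewrite wlength_map.
    by case: (avoiding_map tg aw).
  by rewrite -gu -su.
Qed.

(** An entry of G controls the n-step extensions of every translate of every
    walk in P_r: translate them back, then use that Fsum is constant on P_r.
    Sums run over duplicate-free lists, so that only inclusions between sets of
    walks are needed. *)
Lemma Fsum_type r s w0 (l : seq (steps L)) : has_type r w0 -> uniq l ->
  (forall w, w \in l -> [/\ avoiding ty w, wlength w = n, first_steps m w = w0 &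
                            has_type s (last_steps m w)]) ->
  \sum_(w <- l) wt w <= G r s * wt w0.
Proof.
move=> tw0 ul lP; rewrite (wt_type tw0) /G mxE divfK; last first.
  exact/lt0r_neq0/weight_gt0.
case: tw0 => w1 Pw1 [fV [fE [tf fw1]]].
case: z_adm => _ /(_ r s _ _ (hgam r) Pw1) ->.
have [gV [gE [tg fgV gfV [fgE gfE]]]] := translation_inv tf.
have -> : \sum_(w <- l) wt w = \sum_(w <- map (map_walk gV gE) l) wt w.
  by rewrite big_map; apply: eq_bigr => w _; rewrite /wt weight_map_translation.
apply: ler_sum_fsum => //.
- by rewrite map_inj_uniq //; apply: can_inj (map_walkK gfV gfE).
- apply: sub_finite_set (finite_walks hdeg w1.1 n) => w [[ww _] lw fw _].
  by split=> //; rewrite -fw.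
- move=> _ /mapP[w /lP[aw lw fw [w2 Pw2 [hV [hE [th hw2]]]]] ->]; split.
  + exact: avoiding_map.
  + by rewrite wlength_map.
  + by rewrite -map_first_steps fw -fw1 map_walkK.
  + exists w2 => //; exists (gV \o hV), (gE \o hE); split.
      exact: translation_comp.
    by rewrite -map_last_steps -hw2 map_walk_comp.
Qed.

(** B h_r bounds the weight, relative to that of w0, of all walks starting
    with w0.  In the induction step a walk of length at least n is split into
    its first n steps y and the tail starting with the last m steps of y; the
    tail is shorter by n - m > 0, hence covered by the induction hypothesis.
    Summing over y gives B (G h)_r, and the short walks add at most B, in total
    B (1 + (G h)_r) = B h_r. *)
Lemma sum_extensions (h : 'I_t -> R) (B : R) :
  (forall r, 0 <= h r) -> (forall r, h r = 1 + \sum_s G r s * h s) ->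
  0 <= B -> (forall r, short_sum <= wt (gam r) * B) ->
  forall N r w0 (l : seq (steps L)), has_type r w0 -> uniq l ->
  (forall w, w \in l ->
     [/\ avoiding ty w, (wlength w <= N)%N & first_steps m w = w0]) ->
  \sum_(w <- l) wt w <= wt w0 * (B * h r).
Proof.
move=> h0 hE B0 short_le.
have short r w0 l : has_type r w0 -> uniq l -> (forall w, w \in l ->
    [/\ avoiding ty w, (wlength w < n)%N & first_steps m w = w0]) ->
    \sum_(w <- l) wt w <= wt w0 * B.
  move=> tw0 ul lP; rewrite (wt_type tw0).
  apply: le_trans (short_walks_bound (u := w0.1) ul _) (short_le r) => w.
  by case/lP => aw lw <-.
elim=> [|N IH] r w0 l tw0 ul lP.
  apply: (le_trans (short r w0 l tw0 ul _)).
    move=> w /lP[aw lw fw]; split=> //.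
    by apply: leq_ltn_trans lw _; apply: leq_ltn_trans hmn.
  rewrite ler_pM2l ?weight_gt0 // ler_peMr // hE lerDl.
  apply: sumr_ge0 => s _; rewrite mulr_ge0 // mxE divr_ge0 ?weight_gt0 //.
  by apply: fsumr_ge0.
rewrite (bigID (fun w => (wlength w < n)%N)) /=.
have -> : wt w0 * (B * h r) =
    wt w0 * B + \sum_s (B * h s) * (G r s * wt w0).
  rewrite [in LHS]hE mulrDr mulr1 mulrDr; congr (_ + _).
  rewrite mulr_sumr mulr_sumr; apply: eq_bigr => s _; ring.
apply: lerD; rewrite -big_filter.
  apply: (short r) => //; first by rewrite filter_uniq.
  by move=> w; rewrite mem_filter => /andP[lw /lP[]].
set l' := [seq w <- l | _].
have ul' : uniq l' by rewrite filter_uniq.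
have l'P w : w \in l' -> [/\ avoiding ty w, (n <= wlength w <= N.+1)%N &
                          first_steps m w = w0].
  by rewrite mem_filter -leqNgt => /andP[nw /lP[aw lw fw]]; rewrite nw.
pose Y := undup (map (first_steps n) l').
have YP y : y \in Y -> [/\ avoiding ty y, wlength y = n & first_steps m y = w0].
  rewrite mem_undup => /mapP[w /l'P[aw /andP[nw _] fw] ->]; split.
  - exact: avoiding_first_steps.
  - by rewrite /Defs.wlength size_takel.
  - by rewrite -fw /first_steps /= take_takel // ltnW.
(* Summing over all classes that the tail may have avoids showing that there
   is only one. *)
have fibre y : y \in Y ->
    \sum_(w <- l' | first_steps n w == y) wt w <=
    \sum_s `[< has_type s (last_steps m y) >]%:R * (B * h s * wt y).
  move=> yY; have [ay ly fy] := YP y yY.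
  have [s ts] : exists s, has_type s (last_steps m y).
    apply: exists_type; first exact: avoiding_drop_steps.
    by rewrite /Defs.wlength /= size_drop -/(Defs.wlength _) ly subKn // ltnW.
  rewrite (bigD1 s) //= asboolT // mul1r -[leLHS]addr0; apply: lerD; last first.
    by apply: sumr_ge0 => s' _; rewrite !mulr_ge0.
  rewrite -big_filter; set ly' := [seq w <- l' | _].
  have ly'P w : w \in ly' -> [/\ avoiding ty w, (n <= wlength w <= N.+1)%N &
                          first_steps n w = y].
    by rewrite mem_filter => /andP[/eqP fw /l'P[aw lw _]].
  pose j := (n - m)%N; have mj : (m + j)%N = n by rewrite subnKC // ltnW.
  have -> : \sum_(w <- ly') wt w = wt (first_steps j y) *
      \sum_(w <- map (drop_steps j) ly') wt w.
    rewrite big_map mulr_sumr big_seq [RHS]big_seq; apply: eq_bigr => w.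
    case/ly'P => aw lw fw; rewrite /wt [LHS](weight_split _ _ j); congr (_ * _).
    by rewrite -fw /first_steps /= take_takel // leq_subr.
  have -> : B * h s * wt y = wt (first_steps j y) *
      (wt (last_steps m y) * (B * h s)).
    rewrite /wt [in LHS](weight_split _ _ j) last_stepsE ly; ring.
  rewrite ler_pM2l ?weight_gt0 //; apply: IH => //.
    rewrite map_inj_in_uniq ?filter_uniq // => w w' /ly'P[_ _ fw] /ly'P[_ _ fw'].
    by apply: (@drop_steps_inj _ _ j n) => //; [exact: leq_subr|rewrite fw].
  move=> _ /mapP[w /ly'P[aw /andP[nw lw] fw] ->]; split.
  - exact: avoiding_drop_steps.
  - rewrite /Defs.wlength /= size_drop; apply: leq_trans (leq_sub2r _ lw) _.
    by rewrite leq_subLR -addn1 addnC leq_add2r subn_gt0.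
  - by rewrite first_drop_steps ?mj // fw.
rewrite (sum_fibres _ (first_steps n)) -/Y.
apply: (@le_trans _ _ (\sum_(y <- Y)
    \sum_s `[< has_type s (last_steps m y) >]%:R * (B * h s * wt y))).
  by rewrite big_seq [leRHS]big_seq; apply: ler_sum => y; exact: fibre.
rewrite exchange_big /=; apply: ler_sum => s _.
apply: (@le_trans _ _ (B * h s *
    \sum_(y <- [seq y <- Y | `[< has_type s (last_steps m y) >]]) wt y)).
  rewrite mulr_sumr big_filter [leRHS]big_mkcond; apply: ler_sum => y _.
  by case: asboolP; rewrite ?mul1r ?mul0r.
apply: ler_wpM2l; first exact: mulr_ge0.
apply: Fsum_type => //; first by rewrite filter_uniq ?undup_uniq.
by move=> y; rewrite mem_filter => /andP[/asboolP ts /YP[]].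
Qed.

(** Group the walks of length at least n by their first m steps.  The bound
    does not depend on the lengths of the walks listed. *)
Lemma walk_sums_bounded (h : 'I_t -> R) k :
  (forall r, 0 <= h r) -> (forall r, h r = 1 + \sum_s G r s * h s) ->
  exists M, forall l : seq (steps L), uniq l ->
    (forall w, w \in l -> avoiding ty w /\ start w = rep k) ->
    \sum_(w <- l) wt w <= M.
Proof.
move=> h0 hE; pose B := \sum_r short_sum / wt (gam r).
have short0 : 0 <= short_sum.
  by apply: sumr_ge0 => j _; apply: fsumr_ge0.
have B0 : 0 <= B by apply: sumr_ge0 => r _; rewrite divr_ge0.
have short_le r : short_sum <= wt (gam r) * B.
  rewrite mulrC -ler_pdivrMr ?weight_gt0 // /B (bigD1 r) //= lerDl.
  by apply: sumr_ge0 => s _; rewrite divr_ge0.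
have ext := sum_extensions h0 hE B0 short_le.
exists (short_sum + short_sum * (B * \sum_r h r)) => l ul lP.
rewrite (bigID (fun w => (wlength w < n)%N)) /=.
apply: lerD; rewrite -big_filter.
  apply: (short_walks_bound (u := rep k)); first by rewrite filter_uniq.
  by move=> w; rewrite mem_filter => /andP[lw /lP[]].
set l' := [seq w <- l | _].
have ul' : uniq l' by rewrite filter_uniq.
have l'P w : w \in l' -> [/\ avoiding ty w, start w = rep k & (n <= wlength w)%N].
  by rewrite mem_filter -leqNgt => /andP[nw /lP[aw sw]].
rewrite (sum_fibres _ (first_steps m)).
set Y := undup _.
have YP y : y \in Y -> [/\ avoiding ty y, start y = rep k & wlength y = m].
  rewrite mem_undup => /mapP[w /l'P[aw sw nw] ->]; split => //.
    exact: avoiding_first_steps.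
  by rewrite /Defs.wlength size_takel // (leq_trans (ltnW hmn)).
apply: (@le_trans _ _ (\sum_(y <- Y) wt y * (B * \sum_r h r))).
  rewrite big_seq [leRHS]big_seq; apply: ler_sum => y yY.
  have [ay sy ly] := YP y yY; have [r tr] := exists_type ay ly.
  rewrite -big_filter; apply: le_trans (ext (\max_(w <- l) wlength w)%N r y _ tr _ _) _.
  - by rewrite filter_uniq.
  - move=> w; rewrite mem_filter => /andP[/eqP fw wl']; split => //.
      by case/l'P: wl'.
    by apply: leq_bigmax_seq => //; move: wl'; rewrite mem_filter => /andP[].
  - apply: ler_wpM2l => //; apply: ler_wpM2l => //.
    by rewrite (bigD1 r) //= lerDl sumr_ge0.
rewrite -mulr_suml; apply: ler_wpM2r; first by rewrite mulr_ge0 // sumr_ge0.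
apply: (short_walks_bound (u := rep k)); first exact: undup_uniq.
by move=> y /YP[ay sy ->].
Qed.

End WalkBound.

(** * The domain of convergence *)

Section Domain.
Variables (R : realType) (L : lattice R) (d : nat) (cls : edge L -> 'I_d).
Variable ty : walk_type.
Implicit Types z : 'rV[R]_d.

(** A partial sum over multi-indices is a sum over the list of the walks they
    count, and no walk is counted twice. *)
Lemma gterm_summable v z (M : R) : (forall i, 0 < z 0 i) ->
  (forall l : seq (steps L), uniq l ->
     (forall w, w \in l -> avoiding ty w /\ start w = v) ->
     \sum_(w <- l) weight cls z w <= M) ->
  abs_summable (gterm cls ty v z).
Proof.
move=> z0 lM.
pose A (n : {ffun 'I_d -> nat}) := [set w : steps L |
  [/\ avoiding ty w, start w = v & forall i, edge_count cls w i = n i]].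
have AP n w : w \in fset_set (A n) -> A n w.
  have [finA|infA] := pselect (finite_set (A n)).
    by rewrite in_fset_set // inE.
  by rewrite /fset_set; case: pselect.
have gE n : gterm cls ty v z n = \sum_(w <- fset_set (A n)) weight cls z w.
  rewrite /gterm /walk_count -/(A n) [RHS]big_seq.
  rewrite (eq_bigr (fun=> monomial z n)) => [|w /AP[_ _ wn]]; last first.
    by apply: eq_bigr => i _; rewrite wn.
  by rewrite -big_seq big_const_seq count_predT iter_addr_0 mulr_natl.
apply/abs_summable_ge0 => [n|].
  by rewrite gE; apply: sumr_ge0 => w _; exact/ltW/weight_gt0.
apply: (@le_lt_trans _ _ M%:E); last exact: ltry.
apply: ge_ereal_sup => _ [X [finX _] <-].
rewrite fsbig_finite // sumEFin lee_fin.
under eq_bigr do rewrite gE.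
rewrite -(big_allpairs_dep (h := fun _ w => w)) /=; apply: lM.
  apply: allpairs_uniq_dep => [|n _|]; [exact: fset_uniq..|].
  move=> p p' /allpairsPdep[n [w [_ /AP[_ _ wn] ->]]].
  case/allpairsPdep => [n' [w' [_ /AP[_ _ wn'] ->]]] /= ww'.
  have -> : n = n' by apply/ffunP => i; rewrite -wn -wn' ww'.
  by rewrite ww'.
by move=> _ /allpairsPdep[n [w [_ /AP[aw sw _] ->]]].
Qed.

Variables (m n : nat) (hmn : (m < n)%N) (t : nat) (P : 'I_t -> set (steps L)).
Variable gam : 'I_t -> steps L.
Hypothesis gamP : forall r, wlength (gam r) = m.

Lemma Fsum_scale z c w0 s :
  Fsum cls ty m n P (c *: z) w0 s = c ^+ n * Fsum cls ty m n P z w0 s.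
Proof.
rewrite /Fsum mulr_fsumr; apply: eq_fsbigr => w; rewrite inE => -[_ <- _ _].
exact: weight_scale.
Qed.

(** The walks counted in row r have n - m steps more than gam r. *)
Lemma Gmx_scale z (c : R) : 0 < c ->
  Gmx cls ty m n P gam (c *: z) = c ^+ (n - m) *: Gmx cls ty m n P gam z.
Proof.
move=> c0; apply/matrixP => r s; rewrite !mxE Fsum_scale weight_scale gamP.
have cm : c ^+ m != 0 by rewrite expf_neq0 // gt_eqF.
have -> : c ^+ n = c ^+ m * c ^+ (n - m) by rewrite -exprD subnKC // ltnW.
by rewrite invfM -[c ^+ m * _ * _]mulrA mulrACA mulfV // mul1r mulrA.
Qed.

Lemma admissible_scale z c : c != 0 ->
  admissible cls ty m n P z -> admissible cls ty m n P (c *: z).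
Proof.
move=> c0 [sym wd]; split=> [s w w' Pw Pw'|r s w w' Pw Pw'].
  have [fV [fE [sf wf fw]]] := sym s w w' Pw Pw'.
  by exists fV, fE; split=> // e; rewrite /edge_weight !mxE [X in _ * X]wf.
by rewrite !Fsum_scale (wd r s w w').
Qed.

End Domain.

Section Openness.
Variables (R : realType) (L : lattice R) (d : nat) (cls : edge L -> 'I_d).
Variables (ty : walk_type) (m n : nat) (hmn : (m < n)%N).
Variables (t : nat) (P : 'I_t -> set (steps L)) (gam : 'I_t -> steps L).
Hypothesis gamP : forall r, wlength (gam r) = m.

(** The points whose boxes make up [Dset]. *)
Definition subcritical : set 'rV[R]_d :=
  [set z | Zset cls ty m n P gam z /\
     exists2 l, dominant_eigenvalue (Gmx cls ty m n P gam z) l & l < 1].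

Lemma exists_expr_mul_lt1 (k : nat) (l : R) : l < 1 ->
  exists2 c : R, 1 < c & c ^+ k * l < 1.
Proof.
move=> l1; have near_lt : \forall c \near 1^'+, c ^+ k * l < 1.
  have polyE c : c ^+ k * l = (l *: 'X^k).[c] by rewrite hornerZ hornerXn mulrC.
  have := @continuous_horner R (l *: 'X^k) 1.
  move=> /cvg_at_right_filter /cvgr_lt; rewrite -polyE expr1n mul1r => /(_ _ l1).
  by apply: filterS => c; rewrite polyE.
have [c [c1 cl]] := @filter_ex _ _ (at_right_proper_filter (1 : R)) _
  (filterI (nbhs_right_gt (1 : R)) near_lt).
by exists c.
Qed.

(** Scale z by c > 1 so close to 1 that c^(n-m) l < 1. *)
Lemma subcritical_enlarge z : subcritical z ->
  exists z' e, [/\ subcritical z', 0 < e & forall i, z 0 i + e <= z' 0 i].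
Proof.
move=> [[z0 zadm zprim] [l dom l1]].
have [c c1 cl] := exists_expr_mul_lt1 (n - m) l1.
have c0 : 0 < c := lt_trans ltr01 c1.
exists (c *: z), (\big[Order.min/1]_i ((c - 1) * z 0 i)); split.
- split; last first.
    exists (c ^+ (n - m) * l); last exact: cl.
    rewrite (Gmx_scale cls ty hmn P gamP z c0).
    exact: (dominant_eigenvalue_scale (exprn_gt0 (n - m) c0) dom).
  split.
  + by move=> i; rewrite mxE mulr_gt0.
  + apply: admissible_scale zadm; exact: lt0r_neq0.
  + rewrite (Gmx_scale cls ty hmn P gamP z c0).
    exact: (primitive_scale (exprn_gt0 (n - m) c0) zprim).
(* The minimum is capped at 1 so that it is positive also when d = 0. *)
- apply/bigmin_gtP; split=> // i _; by rewrite mulr_gt0 // subr_gt0.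
- move=> i; have := bigmin_le 1 i (fun i => (c - 1) * z 0 i).
  by rewrite mxE [X in _ <= X]mulrBl mul1r; lra.
Qed.

Lemma Dset_open : open (Dset cls ty m n P gam).
Proof.
rewrite openE => x [z zs xz]; have [z' [e [z's e0 ze]]] := subcritical_enlarge zs.
apply/nbhs_ballP; exists e => //= y [_ xy]; exists z' => // i.
have := xy 0 i; rewrite -ball_normE /= ltr_distl => /andP[lo hi].
have /andP[zx xz'] := xz i; have := ze i; lra.
Qed.

End Openness.

Theorem corollary4p1 (R : realType) (L : lattice R)
  (K : nat) (rep : 'I_K -> vertex L) (hrep : representatives rep)
  (hdeg : finite_outdegree L) (hconn : strongly_connected L)
  (d : nat) (cls : edge L -> 'I_d) (hcls : edge_classes cls)
  (ty : walk_type) (m n : nat) (hmn : (m < n)%N)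
  (t : nat) (P : 'I_t -> set (steps L))
  (hP : classical_sets.partition [set: 'I_t] P (initial_walks ty rep m))
  (gam : 'I_t -> steps L) (hgam : forall r, P r (gam r)) :
  open (Dset cls ty m n P gam) /\
  forall k : 'I_K,
    (forall x, Dset cls ty m n P gam x ->
       abs_summable (gterm cls ty (rep k) x)) /\
    (forall x, Dset cls ty m n P gam x ->
       analytic_at (gen_fun cls ty (rep k)) x).
Proof.
have gamP r : wlength (gam r) = m by case: (class_avoiding hP (hgam r)).
split; first exact: Dset_open.
move=> k; have summable_at z : subcritical cls ty m n P gam z ->
    abs_summable (gterm cls ty (rep k) z).
  move=> [[z0 zadm [G0 _]] [l dom l1]].
  have [h [h0 hE]] : exists h : 'I_t -> R, (forall r, 0 <= h r) /\
      forall r, h r = 1 + \sum_s Gmx cls ty m n P gam z r s * h s.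
    apply: nonneg_resolvent G0 _ => a /(dominant_eigenvalue_bound dom) al.
    exact: le_lt_trans (ler_norm a) (le_lt_trans al l1).
  have [M lM] := walk_sums_bounded hrep hdeg hcls hmn hP hgam z0 zadm k h0 hE.
  exact: gterm_summable z0 lM.
split=> x [z zs xz].
  apply: le_abs_summable (summable_at z zs) => n'.
  rewrite !normrM ler_wpM2l // !normr_prod; apply: ler_prod => i _.
  rewrite normr_ge0 !normrX lerXn2r ?nnegrE //=.
  have xzi : `|x 0 i| <= z 0 i by rewrite ler_norml.
  exact: le_trans xzi (ler_norm _).
have [z' [e [z's e0 ze]]] := subcritical_enlarge hmn gamP zs.
apply: (power_series_analytic (summable_at z' z's) e0) => i.
by apply: le_trans (ze i); rewrite lerD2r ler_norml.
Qed.
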